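(* Let $d\ge2$ and let $C_1,C_2$ be Archimedean $d$-copulas whose generators $\phi_1,\phi_2$ are regularly varying at $0$ (with indices $-\alpha_1,-\alpha_2$, $\alpha_i\in[0,\infty]$). If $C_1<_{TD}C_2$, then $C_1\le_{loc}C_2$.
   Context: A generator is a continuous, strictly decreasing function $\phi:[0,1]\to[0,\infty]$ with $\phi(1)=0$; it is strict if $\lim_{s\searrow0}\phi(s)=\infty$. A $d$-copula $C$ (grounded, $d$-increasing, uniform margins) is Archimedean with generator $\phi$ if $C(\boldsymbol u)=\phi^{[-1]}(\sum_{k=1}^d\phi(u_k))$ with $\phi^{[-1]}(x)=\inf\{t\in[0,1]:\phi(t)\le x\}$. $\phi$ is regularly varying at $0$ with index $-\alpha$, $\alpha\in[0,\infty)$, if $\lim_{s\searrow0}\phi(ts)/\phi(s)=t^{-\alpha}$ for all $t>0$; with index $-\infty$ if this limit is $\infty$ for $t\in(0,1)$, $1$ for $t=1$, $0$ for $t>1$. Tail dependence function: $\Lambda(\boldsymbol w;C)=\lim_{s\searrow0}C(s\boldsymbol w)/s$. $C_1<_{TD}C_2$ means $\Lambda(\boldsymbol w;C_1)<\Lambda(\boldsymbol w;C_2)$ for all $\boldsymbol w\in(0,\infty)^d$; $C_1\le_{loc}C_2$ means there is $\varepsilon>0$ with $C_1\le C_2$ on $B_\varepsilon(\boldsymbol 0)\cap[0,1]^d$ (Euclidean ball). *)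

(* Defs.v *)
From HB Require Import structures.
From mathcomp Require Import all_boot all_order all_algebra.
From mathcomp Require Import all_classical all_reals all_analysis.
Set Implicit Arguments. Unset Strict Implicit. Unset Printing Implicit Defensive.
Import Order.TTheory GRing.Theory Num.Theory.
Import numFieldNormedType.Exports.
Local Open Scope classical_set_scope.
Local Open Scope ring_scope.

Section Defs.
Variable R : realType.

Definition in_unit_cube d (u : 'I_d -> R) := forall k, 0 <= u k <= 1.

Definition cvolume d (C : ('I_d -> R) -> R) (a b : 'I_d -> R) : R :=
  \sum_(S : {set 'I_d}) (-1) ^+ #|S| * C (fun k => if k \in S then a k else b k).

Definition is_copula d (C : ('I_d -> R) -> R) : Prop :=
  [/\ (forall u, in_unit_cube u -> (exists k, u k = 0) -> C u = 0),
      (forall a b, in_unit_cube a -> in_unit_cube b -> (forall k, a k <= b k) ->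
         0 <= cvolume C a b) &
      (forall u k, in_unit_cube u -> (forall j, j != k -> u j = 1) -> C u = u k)].

Definition is_generator (phi : R -> \bar R) : Prop :=
  [/\ {within `[0, 1], continuous phi},
      (forall x, 0 <= x <= 1 -> (0 <= phi x)%E),
      (forall x y, 0 <= x -> x < y -> y <= 1 -> (phi y < phi x)%E) &
      phi 1 = 0%E].

Definition pinv (phi : R -> \bar R) (x : \bar R) : R :=
  inf [set t : R | 0 <= t <= 1 /\ (phi t <= x)%E].

Definition archimedean d (C : ('I_d -> R) -> R) (phi : R -> \bar R) : Prop :=
  forall u, in_unit_cube u -> C u = pinv phi (\sum_(k < d) phi (u k))%E.

Definition regvar0 (phi : R -> \bar R) (alpha : \bar R) : Prop :=
  match alpha with
  | EFin a => 0 <= a /\ forall t : R, 0 < t ->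
      (fine (phi (t * s)) / fine (phi s)) @[s --> 0^'+] --> t `^ (- a)
  | +oo%E => forall t : R, 0 < t ->
      [/\ t < 1 -> (fine (phi (t * s)) / fine (phi s)) @[s --> 0^'+] --> +oo,
          t = 1 -> (fine (phi (t * s)) / fine (phi s)) @[s --> 0^'+] --> (1 : R) &
          1 < t -> (fine (phi (t * s)) / fine (phi s)) @[s --> 0^'+] --> (0 : R)]
  | -oo%E => False
  end.

Definition tail_dep_lim d (C : ('I_d -> R) -> R) (w : 'I_d -> R) (l : R) : Prop :=
  (C (fun k => s * w k) / s) @[s --> 0^'+] --> l.

Definition TD_lt d (C1 C2 : ('I_d -> R) -> R) : Prop :=
  forall w : 'I_d -> R, (forall k, 0 < w k) ->
    exists l1 l2, [/\ tail_dep_lim C1 w l1, tail_dep_lim C2 w l2 & l1 < l2].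

Definition loc_le d (C1 C2 : ('I_d -> R) -> R) : Prop :=
  exists eps : R, 0 < eps /\ forall u, in_unit_cube u ->
    Num.sqrt (\sum_(k < d) u k ^+ 2) < eps -> C1 u <= C2 u.

End Defs.

(* Main.v *)
Require Import Defs.
From HB Require Import structures.
From mathcomp Require Import all_boot all_order all_algebra.
From mathcomp Require Import all_classical all_reals all_analysis.
From mathcomp Require Import ring lra.
Import Order.TTheory GRing.Theory Num.Theory.
Import numFieldNormedType.Exports.
(* mathcomp.classical.functions also exports a [pinv]. *)
Import Defs.
Local Open Scope classical_set_scope.
Local Open Scope ring_scope.

(** Comparing the tail dependence functions on the diagonal gives
    alpha1 < alpha2.  Generators of copulas of dimension at least 2 are convex,
    so regular variation controls chord slopes, and phi1 / phi2 is nondecreasing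
    on some (0, T).  For u in (0, T)^d with c := C1 u > 0 we have c <= u_k, hence
      phi1 c * sum_k phi2 (u_k) <= phi2 c * sum_k phi1 (u_k) = phi2 c * phi1 c,
    i.e. sum_k phi2 (u_k) <= phi2 c, which is c <= C2 u. *)

(** * Generators and their pseudo-inverses *)

(** Strict decrease gives [phi s < phi 0] for [s > 0], so the value [+oo] can only occur at 0. *)
Lemma generator_fin (R : realType) (phi : R -> \bar R) (s : R) :
  is_generator phi -> 0 < s <= 1 -> phi s = (fine (phi s))%:E.
Proof.
case=> _ phi0 phid _ /andP[s0 s1].
have := phid 0 s (lexx _) s0 s1; have := phi0 s; rewrite s1 ltW// => /(_ isT).
by case: (phi s) => // _; rewrite ltNge leey.
Qed.

Lemma generator_lt (R : realType) (phi : R -> \bar R) (s t : R) :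
  is_generator phi -> 0 < s -> s < t -> t <= 1 -> fine (phi t) < fine (phi s).
Proof.
move=> G s0 st t1; rewrite -lte_fin -!generator_fin ?s0 ?(lt_trans s0 st) ?t1 //.
  by case: G => _ _ phid _; apply: phid => //; exact: ltW.
by rewrite (ltW (lt_le_trans st t1)).
Qed.

Lemma generator_gt0 (R : realType) (phi : R -> \bar R) (s : R) :
  is_generator phi -> 0 < s < 1 -> 0 < fine (phi s).
Proof.
move=> G /andP[s0 s1]; have := generator_lt _ _ _ _ G s0 s1 (lexx _).
by case: G => _ _ _ ->.
Qed.

Lemma generator_continuous (R : realType) (phi : R -> \bar R) (a b : R) :
  is_generator phi -> 0 < a -> b <= 1 ->
  {within `[a, b], continuous (fine \o phi)}.
Proof.
move=> G a0 b1; apply: within_continuous_comp.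
  move=> y /set_mem[x] /=; rewrite in_itv /= => /andP[ax xb] <-.
  rewrite (generator_fin _ _ _ G); last by rewrite (lt_le_trans a0 ax) (le_trans xb).
  by apply: fine_cvg; exact: cvg_id.
case: G => phic _ _ _; apply: continuous_subspaceW phic => x /=.
by rewrite !in_itv /= => /andP[ax xb]; rewrite (le_trans xb b1) (le_trans (ltW a0)).
Qed.

Lemma pinv_le (R : realType) (phi : R -> \bar R) (s : R) (x : \bar R) :
  0 <= s <= 1 -> (phi s <= x)%E -> pinv phi x <= s.
Proof.
move=> s01 sx; apply: ge_inf; last by [].
by exists 0 => t [/andP[]].
Qed.

Lemma le_pinv (R : realType) (phi : R -> \bar R) (s : R) (x : \bar R) :
  is_generator phi -> 0 <= s <= 1 -> (0 <= x)%E -> (x <= phi s)%E ->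
  s <= pinv phi x.
Proof.
case=> _ _ phid phi1 /andP[s0 s1] x0 xs; apply: lb_le_inf.
  by exists 1; rewrite /= phi1 ler01 lexx.
move=> t /= [/andP[t0 t1] tx]; rewrite leNgt; apply/negP => ts.
by have := lt_le_trans (phid _ _ t0 ts s1) (le_trans tx xs); rewrite ltxx.
Qed.

Lemma pinv_generatorK (R : realType) (phi : R -> \bar R) (s : R) :
  is_generator phi -> 0 <= s <= 1 -> pinv phi (phi s) = s.
Proof.
move=> G s01; apply/eqP; rewrite eq_le pinv_le//= le_pinv//.
by case: G => _ + _ _; exact.
Qed.

Lemma generator_surj (R : realType) (phi : R -> \bar R) (s : R) (x : \bar R) :
  is_generator phi -> 0 < s <= 1 -> (0 <= x)%E -> (x <= phi s)%E ->
  exists2 c, s <= c <= 1 & phi c = x.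
Proof.
move=> G s01 x0 xs; have /andP[s0 s1] := s01.
have xf : x = (fine x)%:E.
  by move: x0 xs; rewrite (generator_fin _ _ _ G s01); case: x.
have [||c] := @IVT R (fine \o phi) s 1 (fine x) s1.
- exact: generator_continuous.
- have -> : (fine \o phi) 1 = 0 by case: G => _ _ _ /= ->.
  rewrite ge_min le_max -!lee_fin -xf x0 orbT /= orbC /=.
  by rewrite -(generator_fin _ _ _ G s01) xs orbT.
- rewrite in_itv /= => sc cx; exists c => //.
  rewrite (generator_fin _ _ _ G) ?cx//.
  by have /andP[sc' ->] := sc; rewrite (lt_le_trans s0 sc').
Qed.

(** Points below a positive infimum lie outside the set defining [pinv], so [x] is at most
    [phi (c / 2)] and the intermediate value theorem makes it a value of [phi]. Positivity excludes
    the values [x] above [phi 0] of a non-strict generator. *)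
Lemma pinv_gt0K (R : realType) (phi : R -> \bar R) (x : \bar R) :
  is_generator phi -> (0 <= x)%E -> 0 < pinv phi x ->
  pinv phi x <= 1 /\ phi (pinv phi x) = x.
Proof.
move=> G x0 c0; have c1 : pinv phi x <= 1.
  by apply: pinv_le; rewrite ?ler01 ?lexx//; case: G => _ _ _ ->.
split=> //; set c := pinv phi x in c0 c1 *.
have h01 : 0 < c / 2 <= 1 by apply/andP; split; lra.
have [|c' /andP[c'0 c'1] c'x] := generator_surj _ _ _ x G h01 x0.
  rewrite leNgt; apply/negP => xh.
  have : c <= c / 2 by apply: pinv_le; [lra|exact: ltW].
  lra.
by rewrite -c'x /c -c'x pinv_generatorK//; lra.
Qed.

(** * Convexity of the generator of a copula *)

(* Subtracting a small multiple of (t - a)(b - t) makes f strictly midconvex,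
   and a strictly midconvex function has no interior maximum. *)
Lemma midconvex_convex (R : realType) (f : R -> R) (a b : R) :
  {within `[a, b], continuous f} ->
  (forall x y, a <= x -> x < y -> y <= b ->
    f ((x + y) / 2) <= (f x + f y) / 2) ->
  forall y, a <= y <= b -> (b - a) * f y <= f a * (b - y) + f b * (y - a).
Proof.
move=> fc fm y /andP[ay yb].
have [ayE|nay] := eqVneq y a; first by rewrite ayE; nra.
have [ybE|nyb] := eqVneq y b; first by rewrite ybE; nra.
have {nay}ay' : a < y by rewrite lt_neqAle eq_sym nay.
have {nyb}yb' : y < b by rewrite lt_neqAle nyb.
rewrite leNgt; apply/negP => yD.
(* [P] is minus the chord, scaled by [b - a]; [D] is the scaled excess of [f] over the chord at
   [y]. *)
pose P t : R := - (f a * (b - t)) - f b * (t - a).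
pose D := (b - a) * f y + P y.
have D0 : 0 < D by rewrite /D /P; lra.
have p0 : 0 < (y - a) * (b - y) by rewrite mulr_gt0// subr_gt0.
(* With this [e] the correction costs only [D / 2] at [y], so [F y = D / 2] stays positive. As [F]
   vanishes at [a] and [b], its maximum is interior. *)
pose e := D / (2 * ((y - a) * (b - y))).
have e0 : 0 < e by rewrite divr_gt0// mulr_gt0.
have eE : e * ((y - a) * (b - y)) = D / 2.
  rewrite /e; field; rewrite !gt_eqF ?subr_gt0//.
pose Q t : R := P t - e * ((t - a) * (b - t)).
pose F t := (b - a) * f t + Q t.
have [||c] := @EVT_max R F a b.
- by lra.
- have Qc : continuous Q.
    move=> x; rewrite /Q /P.
    by repeat first [apply: cvgB|apply: cvgN|apply: cvgM|apply: cvg_cst|apply: cvg_id].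
  move=> x; apply: cvgD; last exact: continuous_subspaceT.
  by apply: cvgM; [exact: cvg_cst|exact: fc].
rewrite in_itv /= => /andP[ac cb] Fc.
have Fy : 0 < F c.
  apply: (@lt_le_trans _ _ (F y)); last by apply: Fc; rewrite in_itv /= ay yb.
  by rewrite /F /Q addrA -/D eE; lra.
have Fa : F a = 0 by rewrite /F /Q /P; ring.
have Fb : F b = 0 by rewrite /F /Q /P; ring.
have {}ac : a < c by rewrite lt_neqAle ac andbT; apply/eqP => E; move: Fy; rewrite -E Fa ltxx.
have {}cb : c < b by rewrite lt_neqAle cb andbT; apply/eqP => E; move: Fy; rewrite E Fb ltxx.
have [h [h0 hac hcb]] : exists h : R, [/\ 0 < h, h <= c - a & h <= b - c].
  by exists (Num.min (c - a) (b - c)); rewrite lt_min !ge_min !lexx orbT !subr_gt0 ac cb.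
have m1 : F (c - h) <= F c by apply: Fc; rewrite in_itv /=; lra.
have m2 : F (c + h) <= F c by apply: Fc; rewrite in_itv /=; lra.
have : f c <= (f (c - h) + f (c + h)) / 2.
  by rewrite [X in f X](_ : c = ((c - h) + (c + h)) / 2); [apply: fm; lra|field].
have ba : 0 < b - a by lra.
move=> /(ler_wpM2l (ltW ba)).
have he : 0 < e * (h * h) by apply: mulr_gt0 => //; apply: mulr_gt0.
have -> : (b - a) * f c = F c - Q c by rewrite /F; ring.
have -> : (b - a) * ((f (c - h) + f (c + h)) / 2) =
    (F (c - h) - Q (c - h) + (F (c + h) - Q (c + h))) / 2 by rewrite /F; field.
(* The second difference of [Q] is strictly positive, so with midconvexity
   [F (c - h) + F (c + h) > 2 * F c], against maximality at [c]. *)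
have : Q (c - h) + Q (c + h) = 2 * Q c + 2 * (e * (h * h)) by rewrite /Q /P; ring.
lra.
Qed.

(** The chord inequality cleared of denominators. The point 0 is left out because a strict generator
    is infinite there. *)
Definition convex_on_unit (R : realType) (f : R -> R) := forall x y z,
  0 < x -> x <= y -> y <= z -> z <= 1 ->
  (z - x) * f y <= f x * (z - y) + f z * (y - x).

(** Filling up with 1 selects a bivariate margin: the other coordinates contribute [phi 1 = 0] to
    the Archimedean sum. *)
Definition two_coords (R : realType) (d : nat) (i j : 'I_d) (x y : R) : 'I_d -> R :=
  fun k => if k == i then x else if k == j then y else 1.

Lemma two_coords_cube (R : realType) (d : nat) (i j : 'I_d) (x y : R) :
  0 <= x <= 1 -> 0 <= y <= 1 -> in_unit_cube (two_coords R d i j x y).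
Proof.
move=> x01 y01 k; rewrite /two_coords; case: ifP => // _; case: ifP => // _.
by rewrite ler01 lexx.
Qed.

Lemma sum_two_coords (R : realType) (d : nat) (i j : 'I_d) (x y : R)
    (phi : R -> \bar R) : i != j -> phi 1 = 0%E ->
  (\sum_(k < d) phi (two_coords R d i j x y k) = phi x + phi y)%E.
Proof.
move=> ij phi1; rewrite (bigD1 i)//= (bigD1 j) 1?eq_sym//= big1 ?adde0.
  by rewrite /two_coords !eqxx eq_sym (negbTE ij).
by move=> k /andP[ki kj]; rewrite /two_coords (negbTE ki) (negbTE kj).
Qed.

(** The box has lower corner [p] in the coordinates [i], [j] and 0 elsewhere. By groundedness only
    the vertices with [S] contained in [{i, j}] survive in its volume. *)
Lemma copula_rect (R : realType) (d : nat) (C : ('I_d -> R) -> R)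
    (i j : 'I_d) (p q : R) : is_copula C -> i != j ->
  0 <= p -> p <= q -> q <= 1 ->
  C (two_coords R d i j p q) + C (two_coords R d i j q p) <=
  C (two_coords R d i j p p) + C (two_coords R d i j q q).
Proof.
move=> [C0 Cinc _] ij p0 pq q1.
have p1 := le_trans pq q1; have q0 := le_trans p0 pq.
pose a k : R := if (k == i) || (k == j) then p else 0.
pose b := two_coords R d i j q q.
have acube : in_unit_cube a.
  by move=> k; rewrite /a; case: ifP => _; rewrite ?p0 ?p1 ?lexx ?ler01.
have bcube : in_unit_cube b by apply: two_coords_cube; rewrite q0 q1.
have ab k : a k <= b k.
  by rewrite /a /b /two_coords; case: eqP => //= _; case: eqP.
have := Cinc _ _ acube bcube ab; rewrite /cvolume.
pose u (S : {set 'I_d}) k := if k \in S then a k else b k.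
have i1 : [set i]%SET != finset.set0 by apply/finset.set0Pn; exists i; rewrite inE.
have j1 : [set j]%SET != finset.set0 by apply/finset.set0Pn; exists j; rewrite inE.
have ij1 : [set i; j]%SET != finset.set0 by apply/finset.set0Pn; exists i; rewrite !inE eqxx.
have nij : [set j]%SET != [set i]%SET by rewrite (inj_eq finset.set1_inj) eq_sym.
have niji : [set i; j]%SET != [set i]%SET.
  by apply/eqP => /finset.setP /(_ j); rewrite !inE eqxx orbT eq_sym (negbTE ij).
have nijj : [set i; j]%SET != [set j]%SET.
  by apply/eqP => /finset.setP /(_ i); rewrite !inE eqxx (negbTE ij).
rewrite (eq_bigr (fun S : {set 'I_d} => (-1) ^+ #|S| * C (u S)))//.
rewrite (bigD1 finset.set0)//= (bigD1 [set i]%SET)//= (bigD1 [set j]%SET) ?nij ?j1//=.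
rewrite (bigD1 [set i; j]%SET) ?niji ?nijj ?ij1//= big1; last first.
  move=> S /andP[/andP[/andP[S0 Si] Sj] Sij].
  (* Any other [S] contains an index outside [{i, j}], where the vertex has coordinate 0. *)
  have [k kS /norP[ki kj]] : exists2 k, k \in S & ~~ ((k == i) || (k == j)).
    case: (boolP [exists k in S, ~~ ((k == i) || (k == j))]) => [/exists_inP//|].
    rewrite negb_exists => /forallP H; exfalso.
    have sub k : k \in S -> (k == i) || (k == j).
      by move=> kS; move: (H k); rewrite kS /= negbK.
    have [iS|iS] := boolP (i \in S); have [jS|jS] := boolP (j \in S).
    - case/eqP: Sij; apply/finset.setP => k; rewrite !inE; apply/idP/idP => [/sub//|].
      by case/orP => /eqP ->.
    - case/eqP: Si; apply/finset.setP => k; rewrite !inE; apply/idP/idP => [kS|/eqP->//].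
      by case/orP: (sub _ kS) => // /eqP E; rewrite E (negbTE jS) in kS.
    - case/eqP: Sj; apply/finset.setP => k; rewrite !inE; apply/idP/idP => [kS|/eqP->//].
      by case/orP: (sub _ kS) => // /eqP E; rewrite E (negbTE iS) in kS.
    - case/eqP: S0; apply/finset.setP => k; rewrite !inE; apply/negP => kS.
      by case/orP: (sub _ kS) => /eqP E; rewrite E ?(negbTE iS) ?(negbTE jS) in kS.
  rewrite C0 ?mulr0//.
    by move=> l; rewrite /u; case: ifP => _; [exact: acube|exact: bcube].
  by exists k; rewrite /u kS /a (negbTE ki) (negbTE kj).
have ijF := negbTE ij; have jiF : (j == i) = false by rewrite eq_sym.
rewrite (_ : u finset.set0 = two_coords R d i j q q); last first.
  by apply/funext => k; rewrite /u inE.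
rewrite (_ : u [set i]%SET = two_coords R d i j p q); last first.
  apply/funext => k; rewrite /u inE /a /b /two_coords.
  by case: eqP => // _.
rewrite (_ : u [set j]%SET = two_coords R d i j q p); last first.
  apply/funext => k; rewrite /u inE /a /b /two_coords.
  by case: (eqVneq k j) => [->|//]; rewrite jiF orbT.
rewrite (_ : u [set i; j]%SET = two_coords R d i j p p); last first.
  apply/funext => k; rewrite /u !inE /a /b /two_coords.
  by case: eqP => //= _; case: eqP.
rewrite cards0 !cards1 cards2 ij expr0 expr1 mul1r !mulN1r sqrrN expr1n mul1r addr0.
lra.
Qed.

(* The rectangle inequality for p = phi^-1(phi x / 2), q = phi^-1(phi y / 2) is
   midconvexity of the pseudo-inverse. *)
Lemma generator_midconvex (R : realType) (d : nat) (C : ('I_d -> R) -> R)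
    (phi : R -> \bar R) (x y : R) : (2 <= d)%N ->
  is_copula C -> is_generator phi -> archimedean C phi ->
  0 < x -> x < y -> y <= 1 ->
  fine (phi ((x + y) / 2)) <= (fine (phi x) + fine (phi y)) / 2.
Proof.
move=> d2 HC G A x0 xy y1.
pose i : 'I_d := Ordinal (ltnW d2); pose j : 'I_d := Ordinal d2.
have ij : i != j by [].
have phi1 : phi 1 = 0%E by case: G.
have x1 := le_trans (ltW xy) y1; have y0 := lt_trans x0 xy.
have xE : phi x = (fine (phi x))%:E by apply: generator_fin; rewrite ?x0.
have yE : phi y = (fine (phi y))%:E by apply: generator_fin; rewrite ?y0.
set X := fine (phi x) in xE *; set Y := fine (phi y) in yE *.
have YX : Y < X by apply: generator_lt.
have Y0 : 0 <= Y.
  by rewrite -lee_fin -yE; case: G => _ + _ _; apply; rewrite y1 ltW.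
have x01 : 0 < x <= 1 by rewrite x0.
have inv z : 0 <= z <= X -> exists2 c, x <= c <= 1 & phi c = z%:E.
  by move=> /andP[z0 zX]; apply: generator_surj => //; rewrite xE lee_fin.
have [p /andP[xp p1] pE] : exists2 c, x <= c <= 1 & phi c = (X / 2)%:E by apply: inv; lra.
have [q /andP[xq q1] qE] : exists2 c, x <= c <= 1 & phi c = (Y / 2)%:E by apply: inv; lra.
have pq : p <= q.
  rewrite leNgt; apply/negP => qp; case: (G) => _ _ /(_ q p) + _.
  rewrite pE qE lte_fin; have : 0 <= q by lra.
  move=> q0 /(_ q0 qp p1); lra.
have [c /andP[xc c1] cE] : exists2 c, x <= c <= 1 & phi c = ((X + Y) / 2)%:E by apply: inv; lra.
have := copula_rect R d C i j p q HC ij.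
have cube u v : x <= u -> u <= 1 -> x <= v -> v <= 1 ->
    C (two_coords R d i j u v) = pinv phi (phi u + phi v)%E.
  move=> *; rewrite A ?sum_two_coords//.
  by apply: two_coords_cube; apply/andP; split; lra.
rewrite !cube// pE qE -!EFinD.
have -> : X / 2 + X / 2 = X by field.
have -> : Y / 2 + Y / 2 = Y by field.
have -> : X / 2 + Y / 2 = (X + Y) / 2 by field.
have -> : Y / 2 + X / 2 = (X + Y) / 2 by field.
rewrite -xE -yE -cE !pinv_generatorK//; [|lra|lra|lra].
have p0 : 0 <= p by lra.
(* The rectangle inequality now reads [c + c <= x + y]; since [phi] decreases, its value at the
   midpoint is at most [phi c]. *)
move=> /(_ p0 pq q1) ccxy.
have -> : (X + Y) / 2 = fine (phi c) by rewrite cE.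
have [->//|cm] := eqVneq c ((x + y) / 2).
apply/ltW/generator_lt => //; first lra.
  by rewrite lt_neqAle cm; lra.
lra.
Qed.

Lemma generator_convex (R : realType) (d : nat) (C : ('I_d -> R) -> R)
    (phi : R -> \bar R) : (2 <= d)%N ->
  is_copula C -> is_generator phi -> archimedean C phi ->
  convex_on_unit R (fine \o phi).
Proof.
move=> d2 HC G A x y z x0 xy yz z1.
apply: (midconvex_convex R (fine \o phi) x z); last by rewrite xy.
  exact: generator_continuous.
move=> u v xu uv vz; apply: (generator_midconvex R d C) => //; lra.
Qed.

(** * Consequences of regular variation at 0 *)

Lemma near_right0_ex (R : realType) (P : R -> Prop) :
  (\forall s \near 0^'+, P s) ->
  exists2 e : R, 0 < e & forall s : R, 0 < s -> s < e -> P s.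
Proof.
case=> e /= e0 H; exists e => // s s0 se; apply: H => //=.
by rewrite sub0r normrN gtr0_norm.
Qed.

(** As [q] decreases to 1, the two sides behave like [a * (q - 1)] and [b * (q - 1)]. The gap leaves
    room for one slope constant separating the two generators. *)
Lemma powR_gap (R : realType) (a b : R) : 0 <= a -> a < b ->
  exists2 q, 1 < q & q * (q `^ a - 1) < 1 - q `^ (- b).
Proof.
move=> a0 ab; have b0 : 0 < b by lra.
(* [dlt] makes [b * (1 - dlt)] the mean of [a] and [b], whence [a * expR dlt < b]. For [q = expR h],
   the product of [q], [q]^ a[and]q [^ b] is [expR dlt]. *)
pose dlt := (b - a) / (2 * b); pose h := dlt / (1 + a + b).
have d0 : 0 < dlt by rewrite divr_gt0//; lra.
have h0 : 0 < h by rewrite divr_gt0//; lra.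
have hE : (1 + a + b) * h = dlt by rewrite /h; field; lra.
have aD : a * expR dlt < b.
  have := expR_ge1Dx (- dlt); rewrite expRN => dV.
  have dE : b * (1 - dlt) = (a + b) / 2 by rewrite /dlt; field; lra.
  have p : 0 < 1 - dlt by rewrite -(pmulr_rgt0 _ b0) dE; lra.
  have : a < b * (expR dlt)^-1.
    apply: (@lt_le_trans _ _ (b * (1 - dlt))); first by rewrite dE; lra.
    by rewrite ler_pM2l.
  by rewrite ltr_pdivlMr ?expR_gt0.
exists (expR h); first by rewrite expR_gt1.
rewrite -!expRM mulrN expRN.
have A1 := expR_ge1Dx (- (h * a)); have B1 := expR_ge1Dx (h * b).
rewrite expRN in A1.
have eD : expR dlt = expR h * expR (h * a) * expR (h * b).
  by rewrite -!expRD -hE; congr expR; ring.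
rewrite eD in aD.
have E0 := expR_gt0 h; have A0 := expR_gt0 (h * a); have B0 := expR_gt0 (h * b).
set E := expR h in E0 eD aD *; set A := expR (h * a) in A0 A1 eD aD *.
set B := expR (h * b) in B0 B1 eD aD *.
have A2 : A - 1 <= A * (h * a).
  have := A1; rewrite -(ler_pM2l A0) mulfV ?gt_eqF//; lra.
rewrite -(ltr_pM2r B0) [ltRHS]mulrBl mul1r mulVf ?gt_eqF//.
apply: (@le_lt_trans _ _ (E * (A * (h * a)) * B)).
  by rewrite ler_pM2r// ler_pM2l.
apply: (@lt_le_trans _ _ (h * b)); last by lra.
have -> : E * (A * (h * a)) * B = h * (a * (E * A * B)) by ring.
by rewrite ltr_pM2l.
Qed.

Lemma regvar0_upper (R : realType) (phi : R -> \bar R) (alpha : \bar R) (b q L : R) :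
  regvar0 phi alpha -> (b%:E <= alpha)%E -> 1 < q -> q `^ (- b) < L ->
  \forall s \near 0^'+, fine (phi (q * s)) / fine (phi s) < L.
Proof.
move=> + + q1 qL; have q0 : 0 < q by lra.
case: alpha => [a [a0 /(_ _ q0) H]|/(_ _ q0)[_ _ /(_ q1) H] _|//].
  rewrite lee_fin => ba; apply: cvgr_lt H _ _; apply: le_lt_trans qL.
  by apply: ler_powR; [lra|rewrite lerN2].
by apply: cvgr_lt H _ _; apply: le_lt_trans qL; exact: powR_ge0.
Qed.

Lemma regvar0_lower (R : realType) (phi : R -> \bar R) (a q L : R) :
  regvar0 phi a%:E -> 1 < q -> q `^ a < L ->
  \forall s \near 0^'+, fine (phi (q^-1 * s)) / fine (phi s) < L.
Proof.
move=> [a0 H] q1 qL; have q0 : 0 < q by lra.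
have qi0 : 0 < q^-1 by rewrite invr_gt0.
apply: cvgr_lt (H _ qi0) _ _; rewrite powRN; suff -> : (q^-1 `^ a)^-1 = q `^ a by [].
have qa0 : q^-1 `^ a != 0 by rewrite gt_eqF ?powR_gt0.
apply: (mulIf qa0); rewrite mulVf// -powRM ?ltW// mulfV ?powR1//.
by rewrite gt_eqF.
Qed.

(** * Chord slopes and monotonicity of [phi1 / phi2] near 0 *)

(* On [t/q, t] the chords of a convex function ending at t are no steeper than
   the chord over [t/q, t], and those left of t at least as steep as the chord
   over [t, q t]. *)
Lemma convex_chord_upper (R : realType) (f : R -> R) (q K s t : R) :
  convex_on_unit R f -> 1 < q -> 0 < t -> t <= 1 ->
  f (q^-1 * t) <= (1 + K * (1 - q^-1)) * f t ->
  q^-1 * t <= s -> s <= t -> f s <= f t * (1 + K * ((t - s) / t)).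
Proof.
move=> fc q1 t0 t1 fK qs st.
have q0 : 0 < q by lra.
have qi0 : 0 < q^-1 by rewrite invr_gt0.
have qi1 : q^-1 < 1 by rewrite invf_lt1.
have := fc _ _ _ (mulr_gt0 qi0 t0) qs st t1.
set r := q^-1 in fK qs qi0 qi1 *.
have B0 : 0 < t - r * t by rewrite -{1}(mul1r t) -mulrBl mulr_gt0// subr_gt0.
move=> H; rewrite -(ler_pM2l B0); apply: le_trans H _.
have -> : (t - r * t) * (f t * (1 + K * ((t - s) / t))) =
    (1 + K * (1 - r)) * f t * (t - s) + f t * (s - r * t) by field; rewrite gt_eqF.
by rewrite lerD2r ler_wpM2r// subr_ge0.
Qed.

Lemma convex_chord_lower (R : realType) (f : R -> R) (q K s t : R) :
  convex_on_unit R f -> 1 < q -> 0 < s -> s <= t -> q * t <= 1 ->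
  f (q * t) <= (1 - K * (q - 1)) * f t ->
  f t * (1 + K * ((t - s) / t)) <= f s.
Proof.
move=> fc q1 s0 st qt1 fK; have t0 : 0 < t by lra.
have tq : t <= q * t by rewrite ler_peMl; lra.
have := fc _ _ _ s0 st tq qt1.
have B0 : 0 < (q - 1) * t by rewrite mulr_gt0// subr_gt0.
have H2 : f (q * t) * (t - s) <= (1 - K * (q - 1)) * f t * (t - s).
  by rewrite ler_wpM2r// subr_ge0.
move=> H; rewrite -(ler_pM2l B0).
have -> : (q - 1) * t * (f t * (1 + K * ((t - s) / t))) =
    (q * t - s) * f t - (1 - K * (q - 1)) * f t * (t - s) by field; rewrite gt_eqF.
have -> : (q - 1) * t = q * t - t by ring.
lra.
Qed.

(** Local monotonicity propagates along [s], [q * s], [q ^+ 2 * s], ..., which passes [t] after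
    finitely many steps by Bernoulli's inequality. *)
Lemma ratio_monotone_chain (R : realType) (g : R -> R) (q T : R) : 1 < q ->
  (forall s t, 0 < s -> s <= t -> t < T -> t <= q * s -> g s <= g t) ->
  forall s t, 0 < s -> s <= t -> t < T -> g s <= g t.
Proof.
move=> q1 step s t s0 st tT.
have bern n : 1 + n%:R * (q - 1) <= q ^+ n.
  elim: n => [|n IH]; first by rewrite mul0r addr0 expr0.
  have n0 : 0 <= n%:R :> R by [].
  rewrite exprS -natr1; apply: (@le_trans _ _ (q * (1 + n%:R * (q - 1)))).
    have := mulr_ge0 n0 (sqr_ge0 (q - 1)); rewrite expr2; lra.
  by rewrite ler_pM2l//; lra.
have [n tn] : exists n, t <= q ^+ n * s.
  exists (Num.bound (t / s / (q - 1))).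
  set n := Num.bound _; have := archi_boundP (x := t / s / (q - 1)).
  rewrite !divr_ge0 ?subr_ge0; [|lra..] => /(_ isT).
  rewrite -/n ltr_pdivrMr ?subr_gt0// ltr_pdivrMr// => H.
  by apply: (le_trans (ltW H)); rewrite ler_pM2r//; have := bern n; lra.
elim: n s s0 st tn => [|n IH] s s0 st tn.
  by apply: step => //; apply: le_trans tn _; rewrite expr0 mul1r ler_peMl; lra.
have [tqs|qst] := leP t (q * s); first exact: step.
apply: (@le_trans _ _ (g (q * s))).
  by apply: step => //; [rewrite ler_peMl; lra|exact: lt_trans tT].
by apply: IH; [rewrite mulr_gt0; lra|exact: ltW|rewrite mulrA -exprSr].
Qed.

(** For [t / q <= s <= t], the same factor [1 + K * ((t - s) / t)] bounds [phi1 s / phi1 t] from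
    above and [phi2 s / phi2 t] from below; the chain lemma removes the restriction on [s]. *)
Lemma ratio_monotone_near0 (R : realType) (phi1 phi2 : R -> \bar R)
    (a b : R) (alpha2 : \bar R) :
  is_generator phi1 -> is_generator phi2 ->
  convex_on_unit R (fine \o phi1) -> convex_on_unit R (fine \o phi2) ->
  regvar0 phi1 a%:E -> regvar0 phi2 alpha2 -> (b%:E <= alpha2)%E ->
  0 <= a -> a < b ->
  exists2 T, 0 < T < 1 & forall s t, 0 < s -> s <= t -> t < T ->
    fine (phi1 s) / fine (phi2 s) <= fine (phi1 t) / fine (phi2 t).
Proof.
move=> G1 G2 c1 c2 r1 r2 b2 a0 ab.
have [q q1 qab] := powR_gap R a b a0 ab.
have {b2}up L := regvar0_upper R phi2 alpha2 b q L r2 b2 q1.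
have q0 : 0 < q by lra.
(* [K * (q - 1)] is the midpoint of the gap from [powR_gap], which gives both strict inequalities on
   the limits below. *)
pose K := (q * (q `^ a - 1) + (1 - q `^ (- b))) / (2 * (q - 1)).
have KE : K * (q - 1) = (q * (q `^ a - 1) + (1 - q `^ (- b))) / 2.
  by rewrite /K; field; lra.
have /(regvar0_lower R phi1 a q _ r1 q1)/near_right0_ex[e1 e10 H1] :
    q `^ a < 1 + K * (1 - q^-1).
  rewrite -(ltr_pM2l q0).
  have -> : q * (1 + K * (1 - q^-1)) = q + K * (q - 1) by field; lra.
  rewrite KE; lra.
have /up/near_right0_ex[e2 e20 H2] :
    q `^ (- b) < 1 - K * (q - 1) by rewrite KE; lra.
have qi0 : 0 < q^-1 by rewrite invr_gt0.
have qi1 : q^-1 < 1 by rewrite invf_lt1.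
(* The bound [q^-1] keeps [q * t] inside the unit interval, as the right-hand chord requires. *)
exists (Num.min q^-1 (Num.min e1 e2)); first by rewrite !lt_min qi0 e10 e20 gt_min qi1.
apply: (ratio_monotone_chain R (fun s => fine (phi1 s) / fine (phi2 s)) q) => //.
move=> s t s0 st; rewrite !lt_min => /andP[tq /andP[te1 te2]] tqs.
have t0 : 0 < t by lra.
have t1 : t < 1 by lra.
have p1 : 0 < fine (phi1 t) by apply: generator_gt0; rewrite ?t0.
have p2 : 0 < fine (phi2 t) by apply: generator_gt0; rewrite ?t0.
have s2 : 0 < fine (phi2 s) by apply: generator_gt0; rewrite // s0; lra.
have U : fine (phi1 s) <= fine (phi1 t) * (1 + K * ((t - s) / t)).
  apply: (convex_chord_upper R (fine \o phi1) q K) => //; first exact: ltW.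
    by move: (H1 t t0 te1); rewrite ltr_pdivrMr// => /ltW.
  by rewrite mulrC ler_pdivrMr// mulrC.
have L : fine (phi2 t) * (1 + K * ((t - s) / t)) <= fine (phi2 s).
  apply: (convex_chord_lower R (fine \o phi2) q K) => //.
    by move: tq; rewrite -[q^-1]mul1r ltr_pdivlMr// mulrC => /ltW.
  by move: (H2 t t0 te2); rewrite ltr_pdivrMr// => /ltW.
rewrite ler_pdivrMr// mulrAC ler_pdivlMr//.
apply: (@le_trans _ _ (fine (phi1 t) * (1 + K * ((t - s) / t)) * fine (phi2 t))).
  by rewrite ler_pM2r.
by rewrite -mulrA ler_pM2l// mulrC.
Qed.

(** * Diagonal tail dependence and the order of the indices *)

Lemma generator_sum_ge0 (R : realType) (d : nat) (phi : R -> \bar R) (u : 'I_d -> R) :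
  is_generator phi -> in_unit_cube u -> (0 <= \sum_(k < d) phi (u k))%E.
Proof. by case=> _ phi0 _ _ u01; apply: sume_ge0 => k _; exact: phi0. Qed.

Lemma archimedean_ge0 (R : realType) (d : nat) (C : ('I_d -> R) -> R)
    (phi : R -> \bar R) (u : 'I_d -> R) :
  is_generator phi -> archimedean C phi -> in_unit_cube u -> 0 <= C u.
Proof.
move=> G A u01; rewrite A//; have S0 := generator_sum_ge0 R d phi u G u01.
apply: lb_le_inf; last by move=> t [/andP[]].
by exists 1; case: G => _ _ _ /= ->; rewrite ler01 lexx.
Qed.

Lemma sum_generator_diag (R : realType) (d : nat) (phi : R -> \bar R) (s : R) :
  is_generator phi -> 0 < s <= 1 ->
  (\sum_(k < d) phi s = (d%:R * fine (phi s))%:E)%E.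
Proof.
move=> G s01; rewrite (generator_fin R phi s)// sumEFin.
by rewrite sumr_const card_ord mulr_natl.
Qed.

Lemma diag_lower_bound (R : realType) (d : nat) (C : ('I_d -> R) -> R)
    (phi : R -> \bar R) (r s : R) : is_generator phi -> archimedean C phi ->
  0 < s -> s <= 1 -> 0 < r -> r * s <= 1 -> C (fun=> s) < r * s ->
  fine (phi (r * s)) < d%:R * fine (phi s).
Proof.
move=> G A s0 s1 r0 rs1 Crs; have rs0 := mulr_gt0 r0 s0.
have s01 : in_unit_cube (fun _ : 'I_d => s) by move=> _; rewrite s1 ltW.
rewrite ltNge; apply/negP => H; move: Crs; rewrite A// ltNge le_pinv//.
- by rewrite rs1 ltW.
- exact: generator_sum_ge0 s01.
- by rewrite sum_generator_diag ?s0// [leRHS](generator_fin R phi)// ?rs0.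
Qed.

Lemma diag_upper_bound (R : realType) (d : nat) (C : ('I_d -> R) -> R)
    (phi : R -> \bar R) (r s : R) : is_generator phi -> archimedean C phi ->
  0 < s -> s <= 1 -> 0 < r -> r * s <= 1 -> r * s < C (fun=> s) ->
  d%:R * fine (phi s) < fine (phi (r * s)).
Proof.
move=> G A s0 s1 r0 rs1 Crs; have rs0 := mulr_gt0 r0 s0.
have s01 : in_unit_cube (fun _ : 'I_d => s) by move=> _; rewrite s1 ltW.
rewrite ltNge; apply/negP => H; move: Crs; rewrite A// ltNge pinv_le//.
- by rewrite rs1 ltW.
- by rewrite sum_generator_diag ?s0// [leLHS](generator_fin R phi)// ?rs0.
Qed.

(* On the diagonal, C(s,...,s) < r s says phi (r s) < d phi(s), and likewise
   for the reverse inequality, so numbers r1 < r2 strictly between the two tail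
   coefficients satisfy r1^(-alpha1) <= d <= r2^(-alpha2) with r2 < 1. *)
Lemma TD_lt_index_lt (R : realType) (d : nat) (C1 C2 : ('I_d -> R) -> R)
    (phi1 phi2 : R -> \bar R) (alpha1 alpha2 : \bar R) : (2 <= d)%N ->
  is_generator phi1 -> is_generator phi2 ->
  archimedean C1 phi1 -> archimedean C2 phi2 ->
  regvar0 phi1 alpha1 -> regvar0 phi2 alpha2 -> TD_lt C1 C2 ->
  exists a b : R, [/\ 0 <= a, a < b, alpha1 = a%:E & (b%:E <= alpha2)%E].
Proof.
move=> d2 G1 G2 A1 A2 r1 r2 /(_ (fun=> 1) (fun=> ltr01))[l1 [l2 []]].
rewrite /tail_dep_lim /=; under eq_fun do rewrite mulr1.
move=> L1; under eq_fun do rewrite mulr1.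
move=> L2 l12.
have dR : 2 <= d%:R :> R by rewrite ler_nat.
have l10 : 0 <= l1.
  rewrite leNgt; apply/negP => l10.
  have /near_right0_ex[e e0 H] : \forall s \near 0^'+, C1 (fun=> s) / s < 0
    by exact: (cvgr_lt l1 L1).
  have [s [s0 se s1]] : exists s : R, [/\ 0 < s, s < e & s < 1].
    by case: (ltP e 1) => e1; [exists (e / 2)|exists (1 / 2)]; split; lra.
  have := H s s0 se; apply/negP; rewrite -leNgt divr_ge0 ?(ltW s0)//.
  by apply: (archimedean_ge0 R d C1 phi1) => // _; rewrite !ltW.
(* These trisect the interval from [l1] to [l2]; [t1 > 0] because [l1 >= 0]. *)
pose t1 := (2 * l1 + l2) / 3; pose t2 := (l1 + 2 * l2) / 3.
have t10 : 0 < t1 by rewrite /t1; lra.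
have t12 : t1 < t2 by rewrite /t1 /t2; lra.
have t20 := lt_trans t10 t12.
have lt1 : l1 < t1 by rewrite /t1; lra.
have lt2 : t2 < l2 by rewrite /t2; lra.
have near1 t : 0 < t -> \forall s \near 0^'+, t * s < 1.
  move=> t0; near=> s; rewrite mulrC -ltr_pdivlMr// mul1r; near: s.
  by apply: nbhs_right_lt; rewrite invr_gt0.
have near_s1 : \forall s \near 0^'+, s < 1 :> R by apply: nbhs_right_lt.
have near_s0 : \forall s \near 0^'+, 0 < s :> R by apply: nbhs_right_gt.
have N1 : \forall s \near 0^'+, fine (phi1 (t1 * s)) / fine (phi1 s) < d%:R.
  near=> s.
  have s0 : 0 < s by near: s.
  have s1 : s < 1 by near: s.
  have ts1 : t1 * s < 1 by near: s; exact: near1.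
  rewrite ltr_pdivrMr ?generator_gt0 ?s0//.
  apply: (diag_lower_bound R d C1) => //; [exact: ltW|exact: ltW|].
  rewrite -ltr_pdivrMr//; near: s; exact: cvgr_lt L1 _ lt1.
have N2 : \forall s \near 0^'+, d%:R < fine (phi2 (t2 * s)) / fine (phi2 s).
  near=> s.
  have s0 : 0 < s by near: s.
  have s1 : s < 1 by near: s.
  have ts1 : t2 * s < 1 by near: s; exact: near1.
  rewrite ltr_pdivlMr ?generator_gt0 ?s0//.
  apply: (diag_upper_bound R d C2) => //; [exact: ltW|exact: ltW|].
  rewrite -ltr_pdivlMr//; near: s; exact: (cvgr_gt l2 L2).
(* If [t2 >= 1], the ratio in [N2] would be at most 1, yet it exceeds [d >= 2]. *)
have t21 : t2 < 1.
  rewrite ltNge; apply/negP => t21.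
  suff : \forall s \near (0 : R)^'+, False by case/near_right0_ex => e e0 /(_ (e / 2)); lra.
  near=> s.
  have s0 : 0 < s by near: s.
  have s1 : s < 1 by near: s.
  have ts1 : t2 * s < 1 by near: s; exact: near1.
  have : d%:R < fine (phi2 (t2 * s)) / fine (phi2 s) by near: s.
  have p0 : 0 < fine (phi2 s) by rewrite generator_gt0 ?s0.
  rewrite ltr_pdivlMr//; have : fine (phi2 (t2 * s)) <= fine (phi2 s).
    have : s <= t2 * s by rewrite ler_peMl// ltW.
    rewrite le_eqVlt => /predU1P[<-//|sts]; apply/ltW/generator_lt => //; exact: ltW.
  nra.
have contra (F : R -> R) (M : R) : (\forall s \near 0^'+, F s < M) ->
    (\forall s \near 0^'+, M < F s) -> False.
  move=> F1 F2; suff : \forall s \near (0 : R)^'+, False.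
    by case/near_right0_ex => e e0 /(_ (e / 2)); lra.
  near=> s; suff : M < M by rewrite ltxx.
  by apply: (@lt_trans _ _ (F s)); near: s.
(* An infinite [alpha1] is impossible: as [t1 < 1], the ratio in [N1] would tend to [+oo]. *)
have [a [aE a0 ad]] : exists a, [/\ alpha1 = a%:E, 0 <= a & t1 `^ (- a) <= d%:R].
  case: alpha1 r1 => [a [a0 /(_ _ t10) H]|/(_ _ t10)[/(_ (lt_trans t12 t21)) H _ _]|//].
    exists a; split => //; rewrite leNgt; apply/negP => dl.
    exact: contra N1 (cvgr_gt _ H _ dl).
  by case: (contra _ _ N1 (cvgry_gt H _)).
exists a; case: alpha2 r2 => [b [b0 /(_ _ t20) H]|_|//]; last first.
  by exists (a + 1); split => //; [lra|rewrite leey].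
exists b; split => //.
have bd : d%:R <= t2 `^ (- b).
  by rewrite leNgt; apply/negP => dl; exact: contra (cvgr_lt _ H _ dl) N2.
rewrite ltNge; apply/negP => ba.
have bn0 : b != 0 by apply/eqP => bE; move: bd; rewrite bE oppr0 powRr0; lra.
have b_gt0 : 0 < b by rewrite lt_neqAle eq_sym bn0.
have : t1 `^ a <= t1 `^ b by apply: ger_powR => //; rewrite t10 ltW// (lt_trans t12).
have : t1 `^ b < t2 `^ b by apply: gt0_ltr_powR => //; rewrite nnegrE ltW.
move=> p1 p2; have : (t2 `^ b)^-1 < (t1 `^ a)^-1.
  by rewrite ltf_pV2 ?posrE ?powR_gt0//; lra.
by rewrite -!powRN; lra.
Unshelve. all: by end_near.
Qed.

(** * Local comparison of the copulas *)

Theorem mainTheorem11 (R : realType) (d : nat) (hd : (2 <= d)%N)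
  (C1 C2 : ('I_d -> R) -> R) (phi1 phi2 : R -> \bar R)
  (hC1 : is_copula C1) (hC2 : is_copula C2)
  (hg1 : is_generator phi1) (hg2 : is_generator phi2)
  (ha1 : archimedean C1 phi1) (ha2 : archimedean C2 phi2)
  (hr1 : exists alpha1, regvar0 phi1 alpha1)
  (hr2 : exists alpha2, regvar0 phi2 alpha2) :
  TD_lt C1 C2 -> loc_le C1 C2.
Proof.
move=> td; case: hr1 hr2 => alpha1 r1 [alpha2 r2].
have [a [b [a0 ab aE b2]]] :=
  TD_lt_index_lt R d C1 C2 phi1 phi2 alpha1 alpha2 hd hg1 hg2 ha1 ha2 r1 r2 td.
rewrite {}aE in r1.
have c1 := generator_convex R d C1 phi1 hd hC1 hg1 ha1.
have c2 := generator_convex R d C2 phi2 hd hC2 hg2 ha2.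
have [T /andP[T0 T1] mono] :=
  ratio_monotone_near0 R phi1 phi2 a b alpha2 hg1 hg2 c1 c2 r1 r2 b2 a0 ab.
clear b2.
exists T; split => // u u01 uT.
(* Each coordinate is at most the Euclidean norm. *)
have uk k : u k < T.
  apply: le_lt_trans uT; have /andP[uk0 _] := u01 k.
  rewrite -[leLHS]ger0_norm// -sqrtr_sqr ler_wsqrtr//.
  by rewrite (bigD1 k)//= lerDl sumr_ge0// => j _; exact: sqr_ge0.
have [c0|] := leP (C1 u) 0.
  by apply: le_trans c0 _; apply: archimedean_ge0 hg2 ha2 u01.
have S0 := generator_sum_ge0 R d phi1 u hg1 u01.
rewrite [C1 u]ha1// => c0; have [c1' cE] := pinv_gt0K R phi1 _ hg1 S0 c0.
set c := pinv phi1 _ in c0 c1' cE *.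
have c01 : 0 < c <= 1 by rewrite c0.
have cu k : c <= u k.
  apply: pinv_le => //; rewrite (bigD1 k)//= leeDl// sume_ge0// => j _.
  by case: hg1 => _ + _ _; apply; exact: u01.
rewrite ha2//; apply: le_pinv => //.
- by rewrite ltW.
- exact: generator_sum_ge0.
have uk01 k : 0 < u k <= 1.
  by rewrite (lt_le_trans c0 (cu k)); case/andP: (u01 k).
have sumE phi : is_generator phi ->
    (\sum_(k < d) phi (u k) = (\sum_(k < d) fine (phi (u k)))%:E)%E.
  by move=> G; rewrite -sumEFin; apply: eq_bigr => k _; exact: generator_fin.
have cT : c < T by apply: le_lt_trans (cu (Ordinal hd)) (uk _).
have pos phi s : is_generator phi -> 0 < s -> s < T -> 0 < fine (phi s).
  by move=> G s0 sT; apply: generator_gt0 => //; rewrite s0 (lt_trans sT).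
rewrite sumE// (generator_fin R phi2 c)// lee_fin.
have p1 := pos phi1 c hg1 c0 cT; have p2 := pos phi2 c hg2 c0 cT.
have S1 : \sum_(k < d) fine (phi1 (u k)) = fine (phi1 c) by rewrite cE sumE.
(* After multiplying by [phi1 c] and expanding it on the right as the sum of the [phi1 (u k)], the
   inequality holds term by term by [mono]. *)
rewrite -(ler_pM2l p1) -[in leRHS]S1 mulr_sumr mulr_suml ler_sum// => k _.
have q2 := pos phi2 _ hg2 (lt_le_trans c0 (cu k)) (uk k).
have := mono c (u k) c0 (cu k) (uk k).
by rewrite ler_pdivrMr// mulrAC ler_pdivlMr.
Qed.
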